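(* Let $G$ be a connected graph on $n$ vertices. Then, for every real $\theta>0$, $$\sum_{i=1}^n e^{\theta\lambda_i(L(G))}\ge \sum_{i=1}^n e^{\theta\lambda_i(L(P_n))}$$ and $$\sum_{i=1}^n e^{\theta\lambda_i(Q(G))}\ge \sum_{i=1}^n e^{\theta\lambda_i(Q(P_n))}.$$
   Context: All graphs are finite, simple, undirected and unweighted. For a graph $G$, $A(G)$ is the adjacency matrix, $D(G)$ the diagonal matrix of vertex degrees, $L(G)=D(G)-A(G)$ the Laplacian matrix and $Q(G)=D(G)+A(G)$ the signless Laplacian matrix. For a real symmetric matrix $M$, $\lambda_1(M)\ge\lambda_2(M)\ge\cdots$ are its eigenvalues repeated with multiplicity. $P_n$ denotes the path on $n$ vertices ($P_1$ is a single vertex). *)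

(* Defs.v *)
From HB Require Import structures.
From mathcomp Require Import all_boot all_order all_algebra.
From mathcomp Require complex.
From mathcomp Require Import polyrcf.
From mathcomp Require Import all_classical all_reals all_analysis.

Set Implicit Arguments.
Unset Strict Implicit.
Unset Printing Implicit Defensive.

Import Order.TTheory GRing.Theory Num.Theory.
Local Open Scope ring_scope.

Record sgraph (n : nat) := SGraph {
  adj :> rel 'I_n;
  adj_sym : symmetric adj;
  adj_irrefl : irreflexive adj }.

Definition sg_connected (n : nat) (G : sgraph n) : Prop :=
  forall x y : 'I_n, connect G x y.

Definition sg_deg (n : nat) (G : sgraph n) (i : 'I_n) : nat :=
  #|[set j | G i j]|.

Definition path_adj (n : nat) : rel 'I_n :=
  fun i j => (i.+1 == j :> nat) || (j.+1 == i :> nat).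

Lemma path_adj_sym n : symmetric (@path_adj n).
Proof. by move=> i j; rewrite /path_adj orbC. Qed.

Lemma path_adj_irrefl n : irreflexive (@path_adj n).
Proof. by move=> i; rewrite /path_adj orbb gtn_eqF. Qed.

Definition path_graph (n : nat) : sgraph n :=
  SGraph (@path_adj_sym n) (@path_adj_irrefl n).

Definition adjmx (R : nzRingType) (n : nat) (G : sgraph n) : 'M[R]_n :=
  \matrix_(i, j) (G i j)%:R.

Definition degmx (R : nzRingType) (n : nat) (G : sgraph n) : 'M[R]_n :=
  diag_mx (\row_i (sg_deg G i)%:R).

Definition laplacian (R : nzRingType) (n : nat) (G : sgraph n) : 'M[R]_n :=
  degmx R G - adjmx R G.

Definition signless_laplacian (R : nzRingType) (n : nat) (G : sgraph n) :
    'M[R]_n :=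
  degmx R G + adjmx R G.

(* [rootsR p] lists the distinct real roots of p increasingly, so the result
   is the weakly decreasing list of the real roots of the characteristic
   polynomial, each repeated according to its multiplicity.  For symmetric M
   these are all the eigenvalues: see [eigenvals_sym] and [size_eigenvals]. *)
Definition eigenvals (R : rcfType) (n : nat) (M : 'M[R]_n) : seq R :=
  flatten [seq nseq (mup x (char_poly M)) x | x <- rev (rootsR (char_poly M))].

(* 0-based: [eigval M i] is the (i+1)-st largest eigenvalue. *)
Definition eigval (R : rcfType) (n : nat) (M : 'M[R]_n) (i : nat) : R :=
  (eigenvals M)`_i.

Lemma count_eigenvals (R : rcfType) (n : nat) (M : 'M[R]_n) (x : R) :
  count_mem x (eigenvals M) = mup x (char_poly M).
Proof.
have p0 : char_poly M != 0 by rewrite monic_neq0 ?char_poly_monic.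
have E (s : seq R) : uniq s -> count_mem x
    (flatten [seq nseq (mup y (char_poly M)) y | y <- s])
  = if x \in s then mup x (char_poly M) else 0%N.
  elim: s => [//|y s IH] /= /andP[ys us].
  rewrite count_cat count_nseq IH // in_cons /= eq_sym.
  case: (eqVneq x y) => [->|_]; last by rewrite mul0n.
  by rewrite (negPf ys) mul1n addn0.
rewrite E; last first.
  by rewrite rev_uniq; apply: (sorted_uniq lt_trans ltxx); apply: sorted_roots.
rewrite mem_rev -(roots_on_rootsR p0) in_itv /=.
by case: ifPn => // /mupNroot.
Qed.

Lemma sorted_eigenvals (R : rcfType) (n : nat) (M : 'M[R]_n) :
  sorted (fun x y : R => y <= x) (eigenvals M).
Proof.
rewrite /eigenvals; set p := char_poly M.
have : sorted (fun x y : R => y < x) (rev (rootsR p)).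
  by rewrite rev_sorted; apply: sorted_roots.
elim: (rev (rootsR p)) => [//|x s IH] /= xs.
have := xs; rewrite path_sortedE; last first.
  by move=> a b c /= ba cb; apply: lt_trans ba.
move=> /andP[/allP lx ss]; rewrite sorted_pairwise; last first.
  by move=> a b c /= ba cb; apply: le_trans ba.
rewrite pairwise_cat -!sorted_pairwise ?IH ?andbT //; last 2 first.
  by move=> a b c /= ba cb; apply: le_trans ba.
  by move=> a b c /= ba cb; apply: le_trans ba.
apply/andP; split.
  apply/allrelP => a b /nseqP[-> _] /flatten_mapP[c /lx cx /nseqP[-> _]].
  exact: ltW.
by elim: (mup x p) => [//|[//|k] IHk] /=; rewrite lexx.
Qed.

Section SymSplit.
Import complex.

Lemma char_poly_sym_split (R : rcfType) (n : nat) (M : 'M[R]_n) :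
  M^T = M -> exists s : seq R, char_poly M = \prod_(a <- s) ('X - a%:P).
Proof.
move=> Msym; pose f : {rmorphism R -> complex R} := real_complex R.
pose MC := map_mx f M.
have MCsym : MC \is hermsymmx.
  apply: realsym_hermsym.
    apply/is_hermitianmxP/matrixP => i j.
    by rewrite expr0 scale1r !mxE -{1}Msym mxE.
  apply/mxOverP => i j; rewrite mxE; by apply/complex_realP; exists (M i j).
have := hermitian_normalmx MCsym; move/orthomx_spectralP.
have := hermitian_spectral_diag_real MCsym.
have := spectral_unit MC.
move: (spectralmx MC) (spectral_diag MC) => P sp Pu spR MCE.
have cpE : char_poly MC = \prod_(i < n) ('X - (sp 0 i)%:P).
  transitivity (char_poly (diag_mx sp)).
    rewrite MCE /char_poly /char_poly_mx !map_mxM /=.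
    set Q := map_mx polyC P; set Qi := map_mx polyC (invmx P).
    have QiQ : Qi *m Q = 1%:M by rewrite -map_mxM mulVmx // map_mx1.
    have -> : 'X%:M - Qi *m map_mx polyC (diag_mx sp) *m Q
        = Qi *m ('X%:M - map_mx polyC (diag_mx sp)) *m Q.
      by rewrite mulmxBr mulmxBl (scalar_mxC 'X Qi) -(mulmxA 'X%:M) QiQ mulmx1.
    by rewrite !det_mulmx mulrAC -det_mulmx QiQ det1 mul1r.
  rewrite char_poly_trig ?diag_mx_is_trig //; apply: eq_bigr => i _.
  by rewrite mxE eqxx.
exists [seq Re (sp 0 i) | i <- enum 'I_n].
apply: (@map_poly_inj _ _ f); rewrite map_char_poly -/MC cpE.
rewrite big_map rmorph_prod big_enum; apply: eq_bigr => i _ /=.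
rewrite rmorphB /= map_polyX map_polyC /=; congr (_ - _%:P).
have /mxOverP/(_ 0 i) := spR.
by move/RRe_real.
Qed.

End SymSplit.

Lemma eigenvals_sym (R : rcfType) (n : nat) (M : 'M[R]_n) :
  M^T = M -> char_poly M = \prod_(a <- eigenvals M) ('X - a%:P).
Proof.
move=> /char_poly_sym_split[s sE]; rewrite {1}sE; apply: perm_big.
by apply/allP => x _; rewrite /= count_eigenvals sE mu_prod_XsubC.
Qed.

Lemma size_eigenvals (R : rcfType) (n : nat) (M : 'M[R]_n) :
  M^T = M -> size (eigenvals M) = n.
Proof.
move=> /eigenvals_sym/(congr1 (fun p : {poly R} => size p)).
by rewrite size_char_poly size_prod_XsubC => -[].
Qed.

Lemma laplacian_sym (R : nzRingType) (n : nat) (G : sgraph n) :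
  (laplacian R G)^T = laplacian R G.
Proof.
rewrite /laplacian linearB /= tr_diag_mx; congr (_ - _).
by apply/matrixP => i j; rewrite !mxE adj_sym.
Qed.

Lemma signless_laplacian_sym (R : nzRingType) (n : nat) (G : sgraph n) :
  (signless_laplacian R G)^T = signless_laplacian R G.
Proof.
rewrite /signless_laplacian linearD /= tr_diag_mx; congr (_ + _).
by apply/matrixP => i j; rewrite !mxE adj_sym.
Qed.

(* Main.v *)
Require Import Defs.
From mathcomp Require Import all_boot all_order all_algebra.
From mathcomp Require Import zify ring.

Set Implicit Arguments.
Unset Strict Implicit.
Unset Printing Implicit Defensive.

Import Order.TTheory GRing.Theory Num.Theory.
Local Open Scope ring_scope.

(** Since [exp] has a power series with nonnegative coefficients and
theta > 0, it suffices to compare the traces of all powers: for a sign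
sigma = 1 or -1 write M(G) = D(G) + sigma A(G), so that M is Q or L; the claim
is tr M(G)^k >= tr M(P_n)^k for every k.  As P_n is bipartite, L(P_n) and
Q(P_n) are similar by a diagonal sign matrix ([mxtrace_path_laplacian]), so
that both signs can be compared with Q(P_n).

The matrix M(G) is the sum over the edges xy of the rank-one matrices z z^T
with z = e_x + sigma e_y ([gram_edge_seq]), hence everything reduces to
understanding a rank-one update M = N + z z^T.  From

  z^T N^i M^(j+1) z = z^T N^(i+1) M^j z + (z^T N^i z) (z^T M^j z)

one sees by induction that the numbers z^T N^i M^j z, and with them the
increments tr M^k - tr N^k, are polynomials with nonnegative coefficients in
the numbers s_i = z^T N^i z; in particular they increase with the s_i
([mxform_rank1_le], [mxtrace_rank1_le]).  This has two uses.

- Deleting edges of G decreases the traces, because s_i >= 0 when N is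
  positive semidefinite ([mxtrace_gram_cat_le]).  So G can be replaced by a
  spanning tree.

- A tree T rooted at v with at least one edge is obtained from two smaller
  trees T1, rooted at v, and T2, rooted at w, by adding the edge vw.  Here
  N = M(T1) + M(T2) with disjoint supports and the cross terms of s_i vanish:
  s_i = (M(T1)^i)_vv + (M(T2)^i)_ww, whatever the sign.  The same formula
  holds when two paths P_p, P_q are joined end to end into P_(p+q).  So one
  proves by induction on T both the trace inequality and the rooted inequality
  (M(T)^k)_vv >= (Q(P_m)^k)_00, where m is the number of vertices of T and 0 is
  an end of the path ([rooted_tree_walks_ge]).  For the rooted inequality the
  monotonicity compares v with the vertex of P_(p+q) at the junction, and it
  remains to see that a diagonal entry of Q(P_m)^k is smallest at an end of the
  path ([path_pow_end_le]). *)

(** * Rank-one updates *)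

Definition mxform (R : nzRingType) (n : nat) (u : 'cV[R]_n) (X : 'M[R]_n)
    (v : 'cV[R]_n) : R := (u^T *m X *m v) 0 0.

Lemma mxform_delta (R : nzRingType) n (X : 'M[R]_n) i j :
  mxform (delta_mx i 0) X (delta_mx j 0) = X i j.
Proof. by rewrite /mxform trmx_delta -rowE -colE !mxE. Qed.

Lemma mxformDl (R : nzRingType) n (X : 'M[R]_n) u1 u2 v :
  mxform (u1 + u2) X v = mxform u1 X v + mxform u2 X v.
Proof. by rewrite /mxform linearD /= !mulmxDl mxE. Qed.

Lemma mxformDr (R : nzRingType) n (X : 'M[R]_n) u v1 v2 :
  mxform u X (v1 + v2) = mxform u X v1 + mxform u X v2.
Proof. by rewrite /mxform mulmxDr mxE. Qed.

Lemma mxformZl (R : nzRingType) n (X : 'M[R]_n) a u v :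
  mxform (a *: u) X v = a * mxform u X v.
Proof. by rewrite /mxform linearZ /= -!scalemxAl mxE. Qed.

Lemma mxformZr (R : comNzRingType) n (X : 'M[R]_n) a u v :
  mxform u X (a *: v) = a * mxform u X v.
Proof. by rewrite /mxform -!scalemxAr mxE. Qed.

Section RankOneUpdate.
Variables (R : realDomainType).

(** The last factor [M] of [M ^+ j.+1] is split off next to [N ^+ i]: it either
contributes another [N] or cuts the product at [z *m z^T]. *)
Lemma mxform_powS n (N : 'M[R]_n) (u v z : 'cV[R]_n) (i j : nat) :
  let M := N + z *m z^T in
  mxform u (N ^+ i * M ^+ j.+1) v =
    mxform u (N ^+ i.+1 * M ^+ j) v
    + mxform u (N ^+ i) z * mxform z (M ^+ j) v.
Proof.
move=> M; rewrite /mxform [M ^+ j.+1]exprS {1}/M mulrDl mulrDr.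
rewrite mulrA -exprSr mulmxDr mulmxDl mxE; congr (_ + _).
rewrite -!mulmxE.
have -> : u^T *m (N ^+ i *m (z *m z^T *m M ^+ j)) *m v
        = (u^T *m N ^+ i *m z) *m (z^T *m M ^+ j *m v) by rewrite !mulmxA.
by rewrite mxE big_ord1.
Qed.

(** By [mxform_powS] the numbers u^T N^i M^j v are obtained from the four families
z^T N^k z, u^T N^k z, z^T N^k v and u^T N^k v with sums and products only,
so they are monotone in these as long as the smaller side is nonnegative.  The
dimensions differ because a path on its own vertices is compared with a tree
inside an ambient graph. *)
Lemma mxform_rank1_le m n (N : 'M[R]_m) (z u v : 'cV[R]_m)
    (N' : 'M[R]_n) (z' u' v' : 'cV[R]_n) :
  (forall k, 0 <= mxform z (N ^+ k) z <= mxform z' (N' ^+ k) z') ->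
  (forall k, 0 <= mxform u (N ^+ k) z <= mxform u' (N' ^+ k) z') ->
  (forall k, 0 <= mxform z (N ^+ k) v <= mxform z' (N' ^+ k) v') ->
  (forall k, 0 <= mxform u (N ^+ k) v <= mxform u' (N' ^+ k) v') ->
  forall j i, 0 <= mxform u (N ^+ i * (N + z *m z^T) ^+ j) v
              <= mxform u' (N' ^+ i * (N' + z' *m z'^T) ^+ j) v'.
Proof.
move=> zz uz zv uv.
have step (x : 'cV[R]_m) (x' : 'cV[R]_n) j :
    (forall k, 0 <= mxform x (N ^+ k) z <= mxform x' (N' ^+ k) z') ->
    0 <= mxform z ((N + z *m z^T) ^+ j) v
      <= mxform z' ((N' + z' *m z'^T) ^+ j) v' ->
    (forall i, 0 <= mxform x (N ^+ i * (N + z *m z^T) ^+ j) v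
      <= mxform x' (N' ^+ i * (N' + z' *m z'^T) ^+ j) v') ->
    forall i, 0 <= mxform x (N ^+ i * (N + z *m z^T) ^+ j.+1) v
      <= mxform x' (N' ^+ i * (N' + z' *m z'^T) ^+ j.+1) v'.
  move=> xz /andP[g0 g1] IH i; rewrite !mxform_powS.
  have /andP[l0 l1] := xz i; have /andP[h0 h1] := IH i.+1.
  by rewrite addr_ge0 ?mulr_ge0 // lerD // ler_pM.
(* The recursion for u calls that for z at i = 0, so u = z comes first. *)
have zP j : forall i, 0 <= mxform z (N ^+ i * (N + z *m z^T) ^+ j) v
              <= mxform z' (N' ^+ i * (N' + z' *m z'^T) ^+ j) v'.
  elim: j => [|j IH]; first by move=> i; rewrite !expr0 !mulr1.
  by apply: step => //; have := IH 0%N; rewrite !expr0 !mul1r.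
elim=> [|j IH]; first by move=> i; rewrite !expr0 !mulr1.
by apply: step => //; have := zP j 0%N; rewrite !expr0 !mul1r.
Qed.

(** Moving one factor from [M] to [N] changes the trace by a value of the form
at [z], so the trace inequality telescopes from [M ^+ k] down to [N ^+ k]. *)
Lemma mxtrace_powS n (N : 'M[R]_n) (z : 'cV[R]_n) (i j : nat) :
  let M := N + z *m z^T in
  \tr (M ^+ j.+1 * N ^+ i) =
    \tr (M ^+ j * N ^+ i.+1) + mxform z (N ^+ i * M ^+ j) z.
Proof.
move=> M; rewrite [M ^+ j.+1]exprSr {2}/M mulrDr mulrDl -mulrA -exprS mxtraceD.
congr (_ + _); rewrite /mxform -trace_mx11 -!mulmxE.
by rewrite mulmxA -[LHS]mxtrace_mulC !mulmxA -[LHS]mxtrace_mulC !mulmxA.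
Qed.

Lemma mxtrace_rank1_le m n (N : 'M[R]_m) (z : 'cV[R]_m)
    (N' : 'M[R]_n) (z' : 'cV[R]_n) k :
  (forall i, 0 <= mxform z (N ^+ i) z <= mxform z' (N' ^+ i) z') ->
  \tr ((N + z *m z^T) ^+ k) - \tr (N ^+ k) <=
  \tr ((N' + z' *m z'^T) ^+ k) - \tr (N' ^+ k).
Proof.
move=> zz; set M := N + z *m _; set M' := N' + _.
have : forall j i, \tr (M ^+ j * N ^+ i) - \tr (N ^+ (j + i)) <=
   \tr (M' ^+ j * N' ^+ i) - \tr (N' ^+ (j + i)).
  elim=> [|j IH] i; first by rewrite !expr0 !mul1r !subrr.
  rewrite !mxtrace_powS addSnnS addrAC [leRHS]addrAC lerD //.
  by have /andP[] := mxform_rank1_le zz zz zz zz j i.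
by move=> /(_ k 0%N); rewrite !expr0 !mulr1 addn0.
Qed.
End RankOneUpdate.

(** * Sums of rank-one matrices *)

Section Gram.
Variables (R : realDomainType).
Definition gram n (zs : seq 'cV[R]_n) : 'M[R]_n := \sum_(z <- zs) z *m z^T.

Lemma tr_gram n (zs : seq 'cV[R]_n) : (gram zs)^T = gram zs.
Proof.
by rewrite /gram linear_sum /=; apply: eq_bigr => z _; rewrite trmx_mul trmxK.
Qed.

(** With [N = gram zs] symmetric, the exponent drops by two when [u] is replaced
by [N *m u]; exponents 0 and 1 give sums of squares. *)
Lemma mxform_gram_pow_ge0 n (zs : seq 'cV[R]_n) k (u : 'cV[R]_n) :
  0 <= mxform u (gram zs ^+ k) u.
Proof.
elim/ltn_ind: k u => -[|[|k]] IH u.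
- rewrite /mxform mulmx1 mxE sumr_ge0 // => i _.
  by rewrite mxE -expr2 sqr_ge0.
- rewrite /mxform expr1 mulmx_sumr mulmx_suml summxE sumr_ge0 // => z _.
  rewrite mulmxA -mulmxA mxE big_ord1.
  by rewrite -[z^T *m u]trmxK trmx_mul trmxK [X in _ * X]mxE -expr2 sqr_ge0.
have -> : mxform u (gram zs ^+ k.+2) u
        = mxform (gram zs *m u) (gram zs ^+ k) (gram zs *m u).
  by rewrite /mxform trmx_mul tr_gram exprS exprSr -!mulmxE !mulmxA.
by rewrite IH // ltnW.
Qed.

(** Each vector added is a rank-one update with nonnegative s_i; comparing it with
the update by the zero vector shows that the trace does not decrease. *)
Lemma mxtrace_gram_cat_le n (zs ws : seq 'cV[R]_n) k :
  \tr (gram zs ^+ k) <= \tr (gram (ws ++ zs) ^+ k).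
Proof.
elim: ws => [//|w ws IH] /=; apply: le_trans IH _.
rewrite /gram big_cons -/(gram _) addrC -subr_ge0.
have := @mxtrace_rank1_le R n n (gram (ws ++ zs)) 0 (gram (ws ++ zs)) w k.
rewrite mul0mx addr0 subrr; apply => i.
by rewrite {1 2}/mxform mulmx0 mxE lexx mxform_gram_pow_ge0.
Qed.
End Gram.

(** * The signless Laplacian of a path *)

Section PathWalks.
Implicit Types (m k : nat).

Lemma path_adjE m (i j : 'I_m) :
  path_adj i j = ((j == i.+1 :> nat) + ((0 < i) && (j == i.-1 :> nat)))%N :> nat.
Proof. by rewrite /path_adj; lia. Qed.

Lemma sum_path_adj m (i : 'I_m) (f : nat -> nat) :
  (\sum_(j < m) path_adj i j * f j =
   (if i.+1 < m then f i.+1 else 0) + (if 0 < i then f i.-1 else 0))%N.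
Proof.
under eq_bigr do rewrite path_adjE mulnDl.
rewrite big_split /=; congr (_ + _)%N.
  rewrite -(big_ord1_eq addn f i.+1 m) [RHS]big_mkcond /=; apply: eq_bigr => j _.
  by case: eqP => _; rewrite ?mul1n.
case: ltnP => i0; last first.
  by rewrite big1 // => j _; rewrite ltnNge i0 mul0n.
have im : (i.-1 < m)%N by rewrite (leq_ltn_trans (leq_pred _) (ltn_ord i)).
transitivity (if (i.-1 < m)%N then f i.-1 else 0%N); last by rewrite im.
rewrite -(big_ord1_eq addn f i.-1 m) [RHS]big_mkcond /=; apply: eq_bigr => j _.
by case: eqP => _; rewrite ?mul1n.
Qed.

Lemma sg_deg_path m (i : 'I_m) :
  sg_deg (path_graph m) i = ((0 < i) + (i.+1 < m))%N.
Proof.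
rewrite /sg_deg -sum1_card big_mkcond /=.
transitivity (\sum_(j < m) path_adj i j * 1)%N.
  by apply: eq_bigr => j _; rewrite inE /= muln1; case: path_adj.
rewrite (sum_path_adj i (fun=> 1%N)) addnC; by do 2 case: ifP.
Qed.

(** The entries of the powers of Q(P_m), as natural numbers indexed by natural
numbers: this makes the nearest-neighbour recursion and the index
arithmetic below accessible to linear arithmetic. *)
Fixpoint path_walks m k (i j : nat) : nat :=
  (if k is k'.+1 then
    ((0 < i) + (i.+1 < m)) * path_walks m k' i j
    + ((if i.+1 < m then path_walks m k' i.+1 j else 0)
       + (if 0 < i then path_walks m k' i.-1 j else 0))
  else (i == j))%N.

Lemma path_walksE (R : nzRingType) m k (i j : 'I_m) :
  (signless_laplacian R (path_graph m) ^+ k) i j = (path_walks m k i j)%:R.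
Proof.
elim: k i => [|k IH] i; first by rewrite mxE.
rewrite exprS mxE /= natrD natrM -sg_deg_path.
rewrite -(sum_path_adj i (fun l => path_walks m k l j)) natr_sum.
under eq_bigr do rewrite IH mxE mulrDl.
rewrite big_split /=; congr (_ + _).
  rewrite (bigD1 i) //= big1 ?addr0 => [|l li].
    by rewrite !mxE eqxx mulr1n.
  by rewrite !mxE eq_sym (negPf li) mulr0n mul0r.
by apply: eq_bigr => l _; rewrite natrM mxE.
Qed.

Lemma path_pow_rev (R : nzRingType) m k (i j : 'I_m) :
  (signless_laplacian R (path_graph m) ^+ k) (rev_ord i) (rev_ord j) =
  (signless_laplacian R (path_graph m) ^+ k) i j.
Proof.
elim: k i => [|k IH] i; first by rewrite !mxE (inj_eq rev_ord_inj).
rewrite !exprS !mxE (reindex_inj rev_ord_inj) /=.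
apply: eq_bigr => l _; rewrite IH; congr (_ * _).
rewrite !mxE (inj_eq rev_ord_inj) !sg_deg_path /=.
by congr (_%:R *+ _ + _%:R); have := ltn_ord i; have := ltn_ord l;
  rewrite /path_adj /=; lia.
Qed.

Lemma path_walks_rev m k (i j : nat) : (i < m)%N -> (j < m)%N ->
  path_walks m k (m - i.+1) (m - j.+1) = path_walks m k i j.
Proof.
move=> im jm; apply: (@mulrIn int 1%R); rewrite ?oner_eq0 //.
by rewrite -(path_walksE int k (Ordinal im) (Ordinal jm)) -path_pow_rev path_walksE.
Qed.

Lemma trmx_pow (R : comNzRingType) m (M : 'M[R]_m) k :
  (M ^+ k)^T = M^T ^+ k.
Proof.
elim: k => [|k IH]; first by rewrite !expr0 trmx1.
by rewrite exprS exprSr -!mulmxE trmx_mul IH.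
Qed.

Lemma path_walks_sym m k (i j : nat) : (i < m)%N -> (j < m)%N ->
  path_walks m k i j = path_walks m k j i.
Proof.
move=> im jm; apply: (@mulrIn int 1%R); rewrite ?oner_eq0 //.
rewrite -(path_walksE int k (Ordinal im) (Ordinal jm)).
rewrite -(path_walksE int k (Ordinal jm) (Ordinal im)).
by rewrite -{1}signless_laplacian_sym -trmx_pow mxE.
Qed.

(** A discrete maximum principle.  Put d_k(i, j) = Q^k(i+1, j+1) - Q^k(i, j).
Away from the ends d_(k+1)(i, j) = d_k(i-1, j) + 2 d_k(i, j) + d_k(i+1, j), and
at i = 0 the missing term is replaced by Q^k(0, j) + Q^k(0, j+1), which is
nonnegative.  On the line i + j = m - 2 the two entries of the difference are
equal, by the reflection of the path and the symmetry of Q, so the recursion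
never has to leave the half i + j <= m - 2. *)
Lemma path_walks_shift_le m k (i j : nat) : (i + j + 2 <= m)%N ->
  (path_walks m k i j <= path_walks m k i.+1 j.+1)%N.
Proof.
elim: k i => [|k IH] i ijm; first by rewrite /= eqSS.
have [ijE|ijN] := eqVneq (i + j + 2)%N m.
  rewrite -(@path_walks_rev _ _ i j); [|lia|lia].
  have -> : (m - i.+1 = j.+1)%N by lia.
  have -> : (m - j.+1 = i.+1)%N by lia.
  by rewrite path_walks_sym //; lia.
have i2 : (i.+2 < m)%N by lia.
have i1 : (i.+1 < m)%N by lia.
rewrite /= i2 i1 addn1.
have H0 := IH i ijm.
have H1 : (path_walks m k i.+1 j <= path_walks m k i.+2 j.+1)%N by apply: IH; lia.
case: i ijm ijN i2 i1 H0 H1 => [|i] ijm ijN i2 i1 H0 H1; first by rewrite /=; lia.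
have H2 : (path_walks m k i j <= path_walks m k i.+1 j.+1)%N by apply: IH; lia.
by rewrite /=; lia.
Qed.

(** Up to reflection, the index i lies in the left half of the path, where
[path_walks_shift_le] brings it back to 0. *)
Lemma path_pow_end_le (R : numDomainType) m k (i : 'I_m.+1) :
  (signless_laplacian R (path_graph m.+1) ^+ k) ord0 ord0 <=
  (signless_laplacian R (path_graph m.+1) ^+ k) i i.
Proof.
rewrite !path_walksE ler_nat.
have half j : (j + j <= m)%N ->
      (path_walks m.+1 k 0 0 <= path_walks m.+1 k j j)%N.
  elim: j => [//|j IH] jm; apply: leq_trans (IH _) _; first by lia.
  by apply: path_walks_shift_le; lia.
have im := ltn_ord i.
have [/half//|mi] := leqP (i + i)%N m.
by rewrite -(@path_walks_rev _ _ i i) //; apply: half; lia.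
Qed.

(** Conjugation by the diagonal matrix with entries (-1)^i changes the sign of the
entries between vertices of different parity, that is of all edges. *)
Lemma mxtrace_path_laplacian (R : comNzRingType) m k :
  \tr (laplacian R (path_graph m) ^+ k) =
  \tr (signless_laplacian R (path_graph m) ^+ k).
Proof.
pose S : 'M[R]_m := diag_mx (\row_i (-1) ^+ i).
have SS : S * S = 1.
  rewrite -mulmxE mulmx_diag -[RHS]diag_const_mx; congr diag_mx.
  by apply/rowP => i; rewrite !mxE -exprMn mulrNN mulr1 expr1n.
have LE : laplacian R (path_graph m) = S * signless_laplacian R (path_graph m) * S.
  apply/matrixP => i j; rewrite -!mulmxE mul_mx_diag mul_diag_mx !mxE.
  have [->|ij] := eqVneq i j.
    rewrite adj_irrefl subr0 addr0 mulr1n mulrAC -exprMn mulrNN mulr1 expr1n.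
    by rewrite mul1r.
  rewrite !mulr0n sub0r add0r /= /path_adj.
  have [/eqP <-|_] := boolP (i.+1 == j :> nat).
    by rewrite /= mulr1 exprS mulN1r mulrN -exprMn mulrNN mulr1 expr1n.
  have [/eqP <-|_] := boolP (j.+1 == i :> nat).
    by rewrite /= mulr1 exprS mulN1r mulNr -exprMn mulrNN mulr1 expr1n.
  by rewrite /= mulr0 mul0r oppr0.
have -> : laplacian R (path_graph m) ^+ k
        = S * signless_laplacian R (path_graph m) ^+ k * S.
  elim: k => [|k IH]; first by rewrite !expr0 mulr1 SS.
  by rewrite !exprS IH LE !mulrA -(mulrA _ S S) SS mulr1.
by rewrite -!mulmxE [LHS]mxtrace_mulC !mulmxE mulrA SS mul1r.
Qed.

Lemma signless_laplacian_path_cat (R : comNzRingType) p q :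
  let z : 'cV[R]_(p.+1 + q.+1) :=
    delta_mx (lshift _ ord_max) 0 + delta_mx (rshift _ ord0) 0 in
  signless_laplacian R (path_graph (p.+1 + q.+1)) =
  block_mx (signless_laplacian R (path_graph p.+1)) 0
           0 (signless_laplacian R (path_graph q.+1)) + z *m z^T.
Proof.
move=> z; apply/matrixP => i j.
have zzE : (z *m z^T) i j =
    (((i == lshift _ ord_max) + (i == rshift _ ord0)) *
     ((j == lshift _ ord_max) + (j == rshift _ ord0)))%N%:R.
  by rewrite !mxE big_ord1 !mxE !andbT natrM !natrD.
rewrite [RHS]mxE zzE.
have QE m (a b : 'I_m) : signless_laplacian R (path_graph m) a b =
    ((a == b) * ((0 < a) + (a.+1 < m)) + path_adj a b)%N%:R.
  by rewrite !mxE sg_deg_path [RHS]natrD natrM mulr_natl; case: (a == b).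
rewrite QE; case: (split_ordP i) => i' ->; case: (split_ordP j) => j' ->;
  rewrite ?block_mxEul ?block_mxEur ?block_mxEdl ?block_mxEdr ?QE ?mxE ?add0r
    -?natrD; congr (_%:R); have := ltn_ord i'; have := ltn_ord j'; rewrite /path_adj -!val_eqE /=; lia.
Qed.
End PathWalks.

(** * Rooted spanning trees *)

Section Trees.
Variables (n : nat).
Implicit Types (v w x y : 'I_n) (S : {set 'I_n}) (E : seq ('I_n * 'I_n)).

(** [rooted_tree G v S E]: the edges [E] of [G] form a tree with vertex set [S]
and root [v].  The binary join at an edge of the root, rather than a list of
children or the addition of a leaf, is what the rank-one update needs: the root
of the first part stays the root and the second part is attached by its root. *)
Inductive rooted_tree (G : rel 'I_n) :
    'I_n -> {set 'I_n} -> seq ('I_n * 'I_n) -> Prop :=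
| RootedTree1 v : rooted_tree G v [set v] [::]
| RootedTreeJoin v S1 E1 w S2 E2 :
    rooted_tree G v S1 E1 -> rooted_tree G w S2 E2 ->
    [disjoint S1 & S2] -> G v w ->
    rooted_tree G v (S1 :|: S2) ((v, w) :: E1 ++ E2).

Definition sort_edge (e : 'I_n * 'I_n) :=
  if (e.1 < e.2)%N then e else (e.2, e.1).

Definition edge_seq (G : rel 'I_n) : seq ('I_n * 'I_n) :=
  [seq e : 'I_n * 'I_n <- enum {: 'I_n * 'I_n} | (e.1 < e.2)%N && G e.1 e.2].

Lemma rooted_tree_root G v S E : rooted_tree G v S E -> v \in S.
Proof. by elim=> [x|x S1 E1 w S2 E2 _ xS1 _ _ _ _]; rewrite inE ?xS1. Qed.

Lemma rooted_tree_edges G v S E : rooted_tree G v S E ->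
  forall e, e \in E -> [/\ e.1 \in S, e.2 \in S & G e.1 e.2].
Proof.
elim=> [//|x S1 E1 w S2 E2 t1 IH1 t2 IH2 _ xw e].
rewrite inE mem_cat => /or3P[/eqP ->|/IH1[a b c]|/IH2[a b c]] /=.
- by rewrite !inE (rooted_tree_root t1) (rooted_tree_root t2) orbT.
- by rewrite !inE a b.
- by rewrite !inE a b !orbT.
Qed.

Lemma sort_edge_uniq G v S E :
  rooted_tree G v S E -> uniq (map sort_edge E).
Proof.
elim=> [//|x S1 E1 w S2 E2 t1 IH1 t2 IH2 S12 xw] /=.
have [xS1 wS2] := (rooted_tree_root t1, rooted_tree_root t2).
have H U F y : rooted_tree G y U F -> forall e, e \in map sort_edge F ->
    (e.1 \in U) && (e.2 \in U).
  move=> /rooted_tree_edges tU e /mapP[f /tU[f1 f2 _] ->].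
  by rewrite /sort_edge; case: ifP => _ /=; rewrite f1 f2.
have xS2 : x \notin S2 by rewrite (disjointFr S12 xS1).
have wS1 : w \notin S1 by rewrite (disjointFl S12 wS2).
rewrite map_cat mem_cat cat_uniq IH1 IH2 andbT; apply/and3P; split => //.
  rewrite negb_or; apply/andP; split; apply/negP.
    by move=> /(H _ _ _ t1); rewrite /sort_edge; case: ifP => _ /=;
      rewrite (negPf wS1) ?andbF.
  by move=> /(H _ _ _ t2); rewrite /sort_edge; case: ifP => _ /=;
    rewrite (negPf xS2) ?andbF.
apply/hasPn => e /(H _ _ _ t2)/andP[e1 _]; apply/negP => /(H _ _ _ t1)/andP[e2 _].
by rewrite (disjointFr S12 e2) in e1.
Qed.

(** The new leaf goes to the part containing its neighbour, down to a one-vertex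
tree; the other parts are unchanged. *)
Lemma rooted_tree_add_leaf G v S E x y : rooted_tree G v S E ->
  x \in S -> y \notin S -> G x y -> exists E', rooted_tree G v (y |: S) E'.
Proof.
elim=> [u|u S1 E1 w S2 E2 t1 IH1 t2 IH2 S12 uw].
  rewrite !inE => /eqP -> yu uy; exists [:: (u, y)].
  rewrite setUC; apply: (RootedTreeJoin (E1 := [::]) (E2 := [::])) => //.
  - exact: RootedTree1.
  - exact: RootedTree1.
  - by rewrite disjoints1 inE eq_sym.
rewrite inE => xS; rewrite inE negb_or => /andP[y1 y2] xy; case/orP: xS => xS.
  have [E' t'] := IH1 xS y1 xy; exists ((u, w) :: E' ++ E2).
  rewrite setUA; apply: RootedTreeJoin => //.
  by rewrite disjoints_subset subUset sub1set inE y2 -disjoints_subset.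
have [E' t'] := IH2 xS y2 xy; exists ((u, w) :: E1 ++ E').
rewrite setUCA; apply: RootedTreeJoin => //.
by rewrite disjoint_sym disjoints_subset subUset sub1set inE y1
  -disjoints_subset disjoint_sym.
Qed.

(** Grow the tree leaf by leaf: a vertex set without an edge to its complement is
closed under adjacency, hence everything. *)
Lemma connected_rooted_tree (G : sgraph n) v : sg_connected G ->
  exists E, rooted_tree G v [set: 'I_n] E.
Proof.
move=> conG.
have grow k : (k < n)%N -> exists S E, rooted_tree G v S E /\ #|S| = k.+1.
  elim: k => [_|k IH kn].
    by exists [set v], [::]; split; [exact: RootedTree1|rewrite cards1].
  have [S [E [tS cS]]] := IH (ltnW kn).
  have [x xS [y yS xy]] : exists2 x, x \in S & exists2 y, y \notin S & G x y.
    have [/exists_inP[x xS /exists_inP[y yS xy]]|] :=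
      boolP [exists x in S, exists y in ~: S, G x y].
      by exists x => //; exists y; rewrite // -in_setC.
    rewrite negb_exists_in => /forall_inP noE.
    (* Without an edge leaving S, connectedness forces S to be everything. *)
    have closedS : fingraph.closed G S.
      apply: intro_closed => [|x y xy xS]; first exact: sym_connect_sym (adj_sym G).
      apply: contraT => yS; have /exists_inPn/(_ y) := noE x xS.
      by rewrite inE yS xy => /(_ isT).
    have : [set: 'I_n] \subset S.
      apply/subsetP => y _.
      by rewrite -(closed_connect closedS (conG v y)) (rooted_tree_root tS).
    by move=> /subset_leq_card; rewrite cardsT card_ord cS leqNgt kn.
  have [E' tE'] := rooted_tree_add_leaf tS xS yS xy.
  by exists (y |: S), E'; rewrite cardsU1 yS cS.
have n0 : (0 < n)%N by apply: leq_ltn_trans (ltn_ord v).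
have [S [E [tS cS]]] := grow n.-1 (eq_leq (prednK n0)).
have <- : S = setT.
  by apply/eqP; rewrite eqEcard subsetT cardsT card_ord cS prednK /=.
by exists E.
Qed.
End Trees.

(** * Matrices with disjoint supports *)

Section DisjointSupport.
Variables (R : comNzRingType) (n : nat).
Implicit Types (M : 'M[R]_n) (S : {set 'I_n}).

Definition supported_on M S :=
  forall i j, i \notin S -> M i j = 0 /\ M j i = 0.

Lemma supported_pow0 M S k i j : supported_on M S ->
  i \notin S -> j \in S -> (M ^+ k) i j = 0.
Proof.
move=> MS iS jS; case: k => [|k].
  by rewrite mxE; case: eqVneq => // ij; rewrite ij jS in iS.
rewrite exprS mxE big1 // => l _.
by have [-> _] := MS i l iS; rewrite mul0r.
Qed.

Lemma supported_mul0 M1 M2 S1 S2 : supported_on M1 S1 -> supported_on M2 S2 ->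
  [disjoint S1 & S2] -> M1 * M2 = 0.
Proof.
move=> s1 s2 S12; apply/matrixP => i j; rewrite mxE big1 ?mxE // => l _.
have [lS|lS] := boolP (l \in S1).
  by have [-> _] := s2 l j (negbT (disjointFr S12 lS)); rewrite mulr0.
by have [_ ->] := s1 l i lS; rewrite mul0r.
Qed.

(** The exponent 0 is excluded: the identity matrix would be counted twice on the
right. *)
Lemma supported_addX M1 M2 S1 S2 k : supported_on M1 S1 -> supported_on M2 S2 ->
  [disjoint S1 & S2] -> (M1 + M2) ^+ k.+1 = M1 ^+ k.+1 + M2 ^+ k.+1.
Proof.
move=> s1 s2 S12; elim: k => [|k IH]; first by rewrite !expr1.
have M12 : M1 * M2 ^+ k.+1 = 0.
  by rewrite exprS mulrA (supported_mul0 s1 s2 S12) mul0r.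
have M21 : M2 * M1 ^+ k.+1 = 0.
  by rewrite exprS mulrA (supported_mul0 s2 s1) 1?disjoint_sym // mul0r.
by rewrite exprS IH mulrDl !mulrDr M12 M21 addr0 add0r -!exprS.
Qed.

Lemma supported_addXl M1 M2 S1 S2 k i j :
  supported_on M1 S1 -> supported_on M2 S2 -> [disjoint S1 & S2] ->
  j \in S1 -> ((M1 + M2) ^+ k) i j = (M1 ^+ k) i j.
Proof.
move=> s1 s2 S12 jS; case: k => [|k]; first by rewrite !expr0.
rewrite (supported_addX _ s1 s2 S12) mxE.
suff -> : (M2 ^+ k.+1) i j = 0 by rewrite addr0.
rewrite exprSr mxE big1 // => l _.
by have [_ ->] := s2 j l (negbT (disjointFr S12 jS)); rewrite mulr0.
Qed.
End DisjointSupport.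

Lemma block_diag_powE (R : nzRingType) p q (A : 'M[R]_p) (B : 'M[R]_q) k :
  block_mx A 0 0 B ^+ k = block_mx (A ^+ k) 0 0 (B ^+ k).
Proof.
elim: k => [|k IH].
  by rewrite !expr0 -[RHS](@scalar_mx_block _ p q 1).
rewrite exprS IH -mulmxE mulmx_block !mul0mx !mulmx0 !addr0 !add0r.
by rewrite !mulmxE -!exprS.
Qed.

(** * Comparison of trees with paths *)

Section SignedEdges.
Variables (R : realDomainType) (sigma : R) (n : nat).
Hypothesis sigma2 : sigma * sigma = 1.
Implicit Types (v w x y : 'I_n) (S : {set 'I_n}) (E : seq ('I_n * 'I_n)).

Definition edge_vec (e : 'I_n * 'I_n) : 'cV[R]_n :=
  delta_mx e.1 0 + sigma *: delta_mx e.2 0.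

Lemma edge_vec_out (e : 'I_n * 'I_n) S i :
  e.1 \in S -> e.2 \in S -> i \notin S -> edge_vec e i 0 = 0.
Proof.
move=> e1 e2 iS; rewrite !mxE !andbT.
have [ie|_] := eqVneq i e.1; first by rewrite ie e1 in iS.
have [ie|_] := eqVneq i e.2; first by rewrite ie e2 in iS.
by rewrite mulr0 addr0.
Qed.

Lemma gram_supported S E : {in E, forall e, (e.1 \in S) && (e.2 \in S)} ->
  supported_on (gram (map edge_vec E)) S.
Proof.
move=> ES i j iS; rewrite /gram big_map big_seq !summxE.
split; apply: big1 => e /ES/andP[e1 e2]; rewrite mxE big_ord1 [X in _ * X]mxE;
  by rewrite (edge_vec_out e1 e2 iS) ?mul0r ?mulr0.
Qed.

(** Both inequalities are proved together by induction on the tree, the root entries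
of the two parts being the data s_i of the rank-one update at the new edge.  The
trace is stated for positive exponents, since the matrices have different
dimensions and so different traces of the identity. *)
Lemma rooted_tree_walks_ge (G : rel 'I_n) v S E : rooted_tree G v S E ->
  forall m, #|S| = m.+1 -> forall k,
    (signless_laplacian R (path_graph m.+1) ^+ k) ord0 ord0
      <= (gram (map edge_vec E) ^+ k) v v /\
    \tr (signless_laplacian R (path_graph m.+1) ^+ k.+1)
      <= \tr (gram (map edge_vec E) ^+ k.+1).
Proof.
elim=> [x m|x S1 E1 w S2 E2 t1 IH1 t2 IH2 S12 xw m Sm k].
  rewrite cards1 => -[<-] k.
  have -> : signless_laplacian R (path_graph 1) = 0.
    apply/matrixP => i j; rewrite !mxE sg_deg_path !ord1 /=.
    by rewrite /path_adj /= mul0rn add0r.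
  rewrite /gram big_nil !expr0n /= !mxtrace0; split=> //.
  by case: k => [|k]; rewrite ?mulr1n ?mulr0n !mxE ?eqxx.
have [xS1 wS2] := (rooted_tree_root t1, rooted_tree_root t2).
have xS2 : x \notin S2 by rewrite (disjointFr S12 xS1).
have wS1 : w \notin S1 by rewrite (disjointFl S12 wS2).
have S1_gt0 : (0 < #|S1|)%N by rewrite (cardD1 x) xS1.
have S2_gt0 : (0 < #|S2|)%N by rewrite (cardD1 w) wS2.
have s1 : supported_on (gram (map edge_vec E1)) S1.
  by apply: gram_supported => e /(rooted_tree_edges t1)[-> -> _].
have s2 : supported_on (gram (map edge_vec E2)) S2.
  by apply: gram_supported => e /(rooted_tree_edges t2)[-> -> _].
move: IH1 IH2 s1 s2; rewrite /= /gram big_cons map_cat big_cat /=.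
rewrite -!/(gram _) -[edge_vec (x, w)]/(delta_mx x 0 + sigma *: delta_mx w 0).
set M1 := gram _; set M2 := gram _ => IH1 IH2 s1 s2.
have cS : #|S1 :|: S2| = (#|S1| + #|S2|)%N.
  by rewrite cardsU disjoint_setI0 // cards0 subn0.
have [p Sp] : exists p, #|S1| = p.+1 by exists #|S1|.-1; rewrite prednK.
have [q Sq] : exists q, #|S2| = q.+1 by exists #|S2|.-1; rewrite prednK.
have {Sm cS} -> : m = (p + q.+1)%N by apply: succn_inj; rewrite -Sm cS Sp Sq.
have {IH1}IH1 := IH1 _ Sp; have {IH2}IH2 := IH2 _ Sq.
(* On the path side the two parts are the paths on #|S1| and #|S2| vertices, and
   the new edge joins the last vertex a of the first to the first vertex b of the
   second. *)
set z := delta_mx x 0 + _.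
set P1 := signless_laplacian R (path_graph p.+1) in IH1.
set P2 := signless_laplacian R (path_graph q.+1) in IH2.
have PE : signless_laplacian R (path_graph (p + q.+1).+1) = _ :=
  signless_laplacian_path_cat R p q.
move: PE; set z' : 'cV[R]_(p.+1 + q.+1) := _ + _.
set a : 'I_(p.+1 + q.+1) := lshift _ ord_max.
set b : 'I_(p.+1 + q.+1) := rshift _ ord0.
set N' := block_mx _ _ _ _ => PE; set N := M1 + M2.
have P1_end i : (P1 ^+ i) ord_max ord_max = (P1 ^+ i) ord0 ord0.
  have -> : ord_max = rev_ord ord0 :> 'I_p.+1 by apply: val_inj; rewrite /= subn1.
  exact: path_pow_rev.
have P_ge0 m' (i j : 'I_m') l :
  0 <= (signless_laplacian R (path_graph m') ^+ l) i j.
  by rewrite path_walksE ler0n.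
have N'E l : (((N' ^+ l) a a = (P1 ^+ l) ord0 ord0) *
             ((N' ^+ l) b b = (P2 ^+ l) ord0 ord0) *
             ((N' ^+ l) a b = 0) * ((N' ^+ l) b a = 0))%type.
  rewrite block_diag_powE block_mxEul block_mxEdr block_mxEur block_mxEdl !mxE.
  by rewrite P1_end.
have NE l : (((N ^+ l) x x = (M1 ^+ l) x x) *
             ((N ^+ l) w w = (M2 ^+ l) w w) *
             ((N ^+ l) x w = 0) * ((N ^+ l) w x = 0))%type.
  have S21 : [disjoint S2 & S1] by rewrite disjoint_sym.
  have N1 i : (N ^+ l) i x = (M1 ^+ l) i x.
    exact: (supported_addXl _ _ s1 s2 S12).
  have N2 i : (N ^+ l) i w = (M2 ^+ l) i w.
    by rewrite /N addrC (supported_addXl _ _ s2 s1 S21).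
  rewrite !N1 !N2.
  by rewrite (supported_pow0 _ s1 wS1) // (supported_pow0 _ s2 xS2).
have z'E l : mxform z' (N' ^+ l) z' = (P1 ^+ l) ord0 ord0 + (P2 ^+ l) ord0 ord0.
  by rewrite mxformDl !mxformDr !mxform_delta !N'E addr0 add0r.
have zE l : mxform z (N ^+ l) z = (M1 ^+ l) x x + (M2 ^+ l) w w.
  rewrite mxformDl !mxformDr !mxformZl !mxformZr !mxform_delta !NE.
  by rewrite !mulr0 addr0 add0r mulrA sigma2 mul1r.
have zz l : 0 <= mxform z' (N' ^+ l) z' <= mxform z (N ^+ l) z.
  by rewrite z'E zE addr_ge0 ?P_ge0 // lerD ?(IH1 l).1 ?(IH2 l).1.
have az l : 0 <= mxform (delta_mx a 0) (N' ^+ l) z'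
              <= mxform (delta_mx x 0) (N ^+ l) z.
  rewrite !mxformDr !mxformZr !mxform_delta !N'E !NE mulr0 !addr0 P_ge0.
  by rewrite (IH1 l).1.
have za l : 0 <= mxform z' (N' ^+ l) (delta_mx a 0)
              <= mxform z (N ^+ l) (delta_mx x 0).
  rewrite !mxformDl !mxformZl !mxform_delta !N'E !NE mulr0 !addr0 P_ge0.
  by rewrite (IH1 l).1.
have aa l : 0 <= mxform (delta_mx a 0) (N' ^+ l) (delta_mx a 0)
              <= mxform (delta_mx x 0) (N ^+ l) (delta_mx x 0).
  by rewrite !mxform_delta !N'E !NE P_ge0 (IH1 l).1.
rewrite [z *m _ + N]addrC; split.
  (* The root corresponds to the vertex a, inside the joined path. *)
  apply: le_trans (path_pow_end_le R k (a : 'I_(p + q.+1).+1)) _.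
  have /andP[_] := mxform_rank1_le zz az za aa k 0.
  by rewrite !expr0 !mul1r !mxform_delta PE.
have := mxtrace_rank1_le k.+1 zz.
rewrite lerBlDr -PE => /le_trans; apply.
rewrite addrAC -[leRHS]addr0 -addrA lerD // subr_le0.
rewrite block_diag_powE mxtrace_block (supported_addX _ s1 s2 S12) mxtraceD.
by rewrite lerD ?(IH1 k).2 ?(IH2 k).2.
Qed.
End SignedEdges.
Arguments edge_vec {R} sigma {n} e.

(** * From trees to connected graphs *)

Section GraphMatrix.
Variables (R : realDomainType) (sigma : R) (n : nat).
Hypothesis sigma2 : sigma * sigma = 1.

Lemma sum_edge_seq (G : sgraph n) (F : 'I_n -> 'I_n -> R) :
  \sum_(e <- edge_seq G) (F e.1 e.2 + F e.2 e.1) =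
  \sum_x \sum_(y | G x y) F x y.
Proof.
rewrite pair_big_dep /= [RHS](bigID (fun e : 'I_n * 'I_n => (e.1 < e.2)%N)) /=.
rewrite /edge_seq big_filter big_enum_cond /= big_split /=; congr (_ + _).
  by apply: eq_bigl => e; rewrite andbC.
rewrite [RHS](reindex_inj (h := fun e => (e.2, e.1))) /=; last first.
  by move=> [a b] [c d] [-> ->].
apply: eq_bigl => e; rewrite adj_sym -leqNgt [in RHS]leq_eqVlt.
by have [/val_inj ->|_] := eqVneq (e.1 : nat) e.2;
  rewrite ?adj_irrefl ?andbF // andbC.
Qed.

Lemma gram_edge_seq (G : sgraph n) :
  gram (map (edge_vec sigma) (edge_seq G)) =
  degmx R G + sigma *: adjmx R G.
Proof.
apply/matrixP => i j; rewrite /gram big_map summxE.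
pose F x y : R := (i == x)%:R * (j == x)%:R + sigma * ((i == x)%:R * (j == y)%:R).
transitivity (\sum_(e <- edge_seq G) (F e.1 e.2 + F e.2 e.1)).
  apply: eq_bigr => e _; rewrite mxE big_ord1 !mxE !andbT /F.
  have expand (a b c d : R) : (a + sigma * b) * (c + sigma * d) =
      a * c + sigma * (a * d) + (b * d + sigma * (b * c)).
    rewrite -[in RHS](mul1r (b * d)) -sigma2; ring.
  exact: expand.
rewrite sum_edge_seq (bigD1 i) //= [X in _ + X]big1 ?addr0 => [|x xi]; last first.
  apply: big1 => y _.
  by rewrite /F eq_sym (negPf xi) !mul0r mulr0 addr0.
rewrite /F eqxx; under eq_bigr do rewrite !mul1r.
rewrite big_split /= !mxE; congr (_ + _).
  rewrite sumr_const /sg_deg cardsE [j == i]eq_sym.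
  by case: eqP => _; rewrite ?mulr1n ?mulr0n ?mul0rn.
rewrite -mulr_sumr; congr (_ * _).
rewrite big_mkcond (bigD1 j) //= eqxx [X in _ + X]big1 ?addr0; last first.
  by move=> y yj; rewrite eq_sym (negPf yj); case: ifP.
by case: (G i j).
Qed.

Lemma gram_sort_edge (E : seq ('I_n * 'I_n)) :
  gram (map (edge_vec sigma) (map (@sort_edge n) E)) =
  gram (map (edge_vec sigma) E).
Proof.
rewrite /gram !big_map; apply: eq_bigr => -[x y] _.
rewrite /sort_edge /=; case: ifP => // _.
have -> : edge_vec sigma (y, x) = sigma *: edge_vec sigma (x, y).
  by rewrite /edge_vec /= scalerDr scalerA sigma2 scale1r addrC.
by rewrite linearZ /= -scalemxAl -scalemxAr scalerA sigma2 scale1r.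
Qed.

(** The edges of the tree, once sorted, are part of the list of all edges of [G]; the
remaining ones only add to the trace. *)
Lemma mxtrace_rooted_tree_le (G : sgraph n) v S E k : rooted_tree G v S E ->
  \tr (gram (map (edge_vec sigma) E) ^+ k) <=
  \tr ((degmx R G + sigma *: adjmx R G) ^+ k).
Proof.
move=> tE; set F := map (@sort_edge n) E.
have FG : {subset F <= edge_seq G}.
  move=> _ /mapP[e /(rooted_tree_edges tE)[_ _ Ge] ->].
  rewrite mem_filter mem_enum andbT /sort_edge; case: ifPn => [->|] //=.
  rewrite adj_sym Ge andbT -leqNgt leq_eqVlt => /orP[/eqP/val_inj e12|//].
  by move: Ge; rewrite e12 adj_irrefl.
have edge_uniq : uniq (edge_seq G) by rewrite filter_uniq // enum_uniq.
pose F' := [seq e <- edge_seq G | e \notin F].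
have FE : perm_eq (edge_seq G) (F' ++ F).
  apply: uniq_perm => //.
    rewrite cat_uniq filter_uniq // (sort_edge_uniq tE) andbT.
    by apply/hasPn => e eF; rewrite mem_filter eF.
  move=> e; rewrite mem_cat [in RHS]mem_filter.
  by have [/FG ->|_] := boolP (e \in F); rewrite ?orbF.
have -> : degmx R G + sigma *: adjmx R G
        = gram (map (edge_vec sigma) F' ++ map (edge_vec sigma) F).
  rewrite -gram_edge_seq -map_cat; apply: perm_big; exact: perm_map.
by rewrite -gram_sort_edge mxtrace_gram_cat_le.
Qed.

End GraphMatrix.

Lemma mxtrace_connected_ge_path (R : realDomainType) (sigma : R) n
    (G : sgraph n) k : sigma * sigma = 1 -> sg_connected G ->
  \tr (signless_laplacian R (path_graph n) ^+ k) <=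
  \tr ((degmx R G + sigma *: adjmx R G) ^+ k).
Proof.
move=> sigma2; case: n G => [|m] G conG; first by rewrite /mxtrace !big_ord0.
have [E tE] := connected_rooted_tree ord0 conG.
case: k => [|k]; first by rewrite !expr0.
apply: le_trans (mxtrace_rooted_tree_le sigma2 k.+1 tE).
have cS : #|[set: 'I_m.+1]| = m.+1 by rewrite cardsT card_ord.
by have [] := rooted_tree_walks_ge sigma2 tE cS k.
Qed.

(** * Traces of powers and eigenvalues *)

From mathcomp Require complex.
From mathcomp Require Import all_classical all_reals all_analysis.

Lemma char_poly_conj (F : fieldType) n (P D : 'M[F]_n) : P \in unitmx ->
  char_poly (invmx P *m D *m P) = char_poly D.
Proof.
move=> Pu; rewrite /char_poly /char_poly_mx !map_mxM /=.
set Q := map_mx polyC P; set Qi := map_mx polyC (invmx P).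
have QiQ : Qi *m Q = 1%:M by rewrite -map_mxM mulVmx // map_mx1.
have -> : 'X%:M - Qi *m map_mx polyC D *m Q
        = Qi *m ('X%:M - map_mx polyC D) *m Q.
  by rewrite mulmxBr mulmxBl (scalar_mxC 'X Qi) -(mulmxA 'X%:M) QiQ mulmx1.
by rewrite !det_mulmx mulrAC -det_mulmx QiQ det1 mul1r.
Qed.

Lemma mxtrace_conj_diag_pow (F : fieldType) n (P : 'M[F]_n) (d : 'rV[F]_n) k :
  P \in unitmx ->
  \tr ((invmx P *m diag_mx d *m P) ^+ k) = \sum_i d 0 i ^+ k.
Proof.
move=> Pu.
have -> : (invmx P *m diag_mx d *m P) ^+ k
        = invmx P *m diag_mx (\row_i d 0 i ^+ k) *m P.
  elim: k => [|k IH].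
    have -> : \row_i d 0 i ^+ 0 = const_mx 1 by apply/rowP => i; rewrite !mxE.
    by rewrite diag_const_mx mulmx1 mulVmx.
  rewrite exprS IH -mulmxE !mulmxA (mulmxK Pu).
  congr (_ *m _); rewrite -mulmxA mulmx_diag; congr (_ *m diag_mx _).
  by apply/rowP => i; rewrite !mxE exprS.
rewrite mxtrace_mulC mulmxA mulmxV // mul1mx mxtrace_diag.
by apply: eq_bigr => i _; rewrite mxE.
Qed.

Section PowerSums.
Import complex.

(** Over the complex extension, M is unitarily diagonalizable; unique factorization of
the characteristic polynomial identifies the diagonal with the eigenvalues. *)
Lemma mxtrace_pow_eigenvals (R : rcfType) n (M : 'M[R]_n) k :
  M^T = M -> \tr (M ^+ k) = \sum_(x <- eigenvals M) x ^+ k.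
Proof.
move=> Msym; pose f : {rmorphism R -> complex R} := real_complex R.
pose MC := map_mx f M.
have MCsym : MC \is hermsymmx.
  apply: realsym_hermsym.
    apply/is_hermitianmxP/matrixP => i j.
    by rewrite expr0 scale1r !mxE -{1}Msym mxE.
  by apply/mxOverP => i j; rewrite mxE; apply/complex_realP; exists (M i j).
have := orthomx_spectralP (hermitian_normalmx MCsym).
have := spectral_unit MC.
move: (spectralmx MC) (spectral_diag MC) => P d Pu MCE.
have cpE : \prod_(x <- map f (eigenvals M)) ('X - x%:P) =
           \prod_(x <- [seq d 0 i | i <- enum 'I_n]) ('X - x%:P).
  transitivity (char_poly MC).
    rewrite -map_char_poly (eigenvals_sym Msym) rmorph_prod big_map.
    by apply: eq_bigr => x _; rewrite rmorphB /= map_polyX map_polyC.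
  rewrite MCE char_poly_conj // char_poly_trig ?diag_mx_is_trig //.
  rewrite big_map big_enum; apply: eq_bigr => i _.
  by rewrite mxE eqxx mulr1n.
apply: (fmorph_inj f); rewrite -trace_map_mx.
have -> : map_mx f (M ^+ k) = MC ^+ k.
  elim: k => [|k IH]; first by rewrite !expr0 map_mx1.
  by rewrite !exprS -!mulmxE map_mxM IH.
rewrite MCE mxtrace_conj_diag_pow // rmorph_sum.
transitivity (\sum_(x <- map f (eigenvals M)) x ^+ k).
  by rewrite (perm_big _ (prod_XsubC_eq cpE)) big_map big_enum.
by rewrite big_map; apply: eq_bigr => x _; rewrite rmorphXn.
Qed.
End PowerSums.

(** * Sums of exponentials *)

Section ExpSums.
Variable R : realType.
Import numFieldNormedType.Exports.
Local Open Scope classical_set_scope.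

Lemma cvg_sum_series_exp (s : seq R) :
  (fun N : nat => \sum_(x <- s) series (exp_coeff x) N) @ \oo
    --> \sum_(x <- s) expR x.
Proof.
apply: cvg_big => [|x _]; first exact: add_continuous.
exact: is_cvg_series_exp_coeff.
Qed.

(** The partial sums of the exponential series are nonnegative combinations of the
power sums; pass to the limit. *)
Lemma sum_expR_le (s t : seq R) (theta : R) : 0 < theta ->
  (forall k, \sum_(x <- s) x ^+ k <= \sum_(x <- t) x ^+ k) ->
  \sum_(x <- s) expR (theta * x) <= \sum_(x <- t) expR (theta * x).
Proof.
move=> th0 st; rewrite -!(big_map (fun x => theta * x) predT expR).
apply: ler_cvg_to (@cvg_sum_series_exp _) (@cvg_sum_series_exp _) _.
apply: nearW => N /=; rewrite /series /= !(exchange_big _ _ (index_iota _ _)) /=.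
apply: ler_sum => k _; rewrite /exp_coeff /= -!mulr_suml !big_map.
rewrite ler_wpM2r ?invr_ge0 ?ler0n //.
under eq_bigr do rewrite exprMn; under [leRHS]eq_bigr do rewrite exprMn.
by rewrite -!mulr_sumr ler_wpM2l ?exprn_ge0 // ltW.
Qed.
End ExpSums.

Lemma sum_expR_eigval_le (R : realType) n (A B : 'M[R]_n) (theta : R) :
  0 < theta -> A^T = A -> B^T = B ->
  (forall k, \tr (A ^+ k) <= \tr (B ^+ k)) ->
  \sum_(i < n) expR (theta * eigval A i) <=
  \sum_(i < n) expR (theta * eigval B i).
Proof.
move=> th0 Asym Bsym AB.
have sumE (C : 'M[R]_n) : C^T = C -> \sum_(i < n) expR (theta * eigval C i) =
    \sum_(x <- eigenvals C) expR (theta * x).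
  by move=> Csym; rewrite (big_nth 0) size_eigenvals // big_mkord.
rewrite [leLHS](sumE A Asym).
rewrite [leRHS](sumE B Bsym).
apply: (sum_expR_le th0) => k.
rewrite -(mxtrace_pow_eigenvals k Asym).
by rewrite -(mxtrace_pow_eigenvals k Bsym).
Qed.

Theorem corollary3p10 (R : realType) (n : nat) (G : sgraph n)
    (hG : sg_connected G) (theta : R) (htheta : 0 < theta) :
  \sum_(i < n) expR (theta * eigval (laplacian R G) i) >=
    \sum_(i < n) expR (theta * eigval (laplacian R (path_graph n)) i) /\
  \sum_(i < n) expR (theta * eigval (signless_laplacian R G) i) >=
    \sum_(i < n) expR (theta * eigval (signless_laplacian R (path_graph n)) i).
Proof.
split; apply: sum_expR_eigval_le => //;
  rewrite ?laplacian_sym ?signless_laplacian_sym // => k.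
  rewrite mxtrace_path_laplacian /laplacian -scaleN1r.
  by apply: mxtrace_connected_ge_path; rewrite // mulrNN mulr1.
rewrite [X in _ <= \tr (X ^+ k)]/signless_laplacian -[adjmx R G]scale1r.
by apply: mxtrace_connected_ge_path; rewrite // mulr1.
Qed.
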